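(* Let $p\in\mathbb{N}_0$ and let $c_1,c_2,\dots\in\mathbb{C}$ be fixed constants. Suppose $a,b\colon\mathbb{Z}\times\mathbb{R}\to\mathbb{C}$ satisfy $$\sup_{(n,t_p)\in\mathbb{Z}\times\mathbb{R}}\big(|a(n,t_p)|+|b(n,t_p)|\big)<\infty,\quad a(n,\cdot),\,b(n,\cdot)\in C^1(\mathbb{R})\ (n\in\mathbb{Z}),\quad a(n,t_p)\neq0\ \text{for all }(n,t_p)\in\mathbb{Z}\times\mathbb{R},$$ and that $a,b$ solve the $p$th Toda equation $$a_{t_p}=a\,(f_{p+1}^+-f_{p+1}),\qquad b_{t_p}=-(g_{p+1}-g_{p+1}^-)\qquad\text{on }\mathbb{Z}\times\mathbb{R}.$$ Then the following infinite sequence of local conservation laws holds: $$\partial_{t_p}\ln(a)-(S^+-I)f_{p+1}=0,$$ $$\partial_{t_p}\rho_{\pm,j}+(S^+-I)J_{\pm,p,j}=0,\qquad j\in\mathbb{N},$$ where $$J_{+,p,j}=-2a^2\sum_{\ell=0}^p f_\ell\,\phi_{+,p+j-\ell},\qquad J_{-,p,j}=-2\sum_{\ell=0}^p f_\ell\,\phi_{-,p+j-\ell}.$$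
   Context: $\mathbb{N}=\{1,2,\dots\}$, $\mathbb{N}_0=\mathbb{N}\cup\{0\}$. For a sequence $c$ on $\mathbb{Z}$ (possibly depending on time), $(S^{\pm}c)(n)=c^{\pm}(n)=c(n\pm1)$; $I$ is the identity. $\partial_{t_p}\ln(a)$ means $a_{t_p}/a$. Toda coefficients: at each fixed time let $L=aS^++a^-S^-+b$. The homogeneous coefficients are $$\hat f_\ell(n)=(\delta_n,L^\ell\delta_n)_{\ell^2(\mathbb{Z})},\qquad \hat g_\ell(n)=-2a(n)(\delta_{n+1},L^\ell\delta_n)_{\ell^2(\mathbb{Z})},\qquad \ell\in\mathbb{N}_0,$$ where $\delta_n$ is the standard basis of $\ell^2(\mathbb{Z})$. With $c_0=1$ put $$f_\ell=\sum_{k=0}^{\ell}c_{\ell-k}\hat f_k,\qquad g_\ell=\sum_{k=1}^{\ell}c_{\ell-k}\hat g_k-c_{\ell+1},\qquad \ell\in\mathbb{N}_0.$$ Equivalently, $f_\ell,g_\ell$ are the solutions of the recursion $f_0=1$, $g_0=-c_1$, $2f_{\ell+1}+g_\ell+g_\ell^--2bf_\ell=0$, $g_{\ell+1}-g_{\ell+1}^-+2(a^2f_\ell^+-(a^-)^2f_\ell^-)-b(g_\ell-g_\ell^-)=0$, with summation constants $c_\ell$; the homogeneous ones correspond to $c_\ell=0$ for all $\ell\ge1$. The quantities $\phi_{\pm,j}$ are defined by $$\phi_{+,1}=1,\quad \phi_{+,2}=b^+,\quad \phi_{+,j+1}=b^+\phi_{+,j}+(a^+)^2\sum_{\ell=1}^{j-1}\phi^+_{+,j-\ell}\phi_{+,\ell}\quad(j\ge2),$$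 $$\phi_{-,-1}=1,\quad\phi_{-,0}=-b,\quad\phi_{-,1}=-(a^-)^2,\quad\phi_{-,j+1}=-b\,\phi^-_{-,j}-\sum_{\ell=0}^{j}\phi_{-,j-\ell}\phi^-_{-,\ell}\quad(j\ge1),$$ and the conserved densities $\rho_{\pm,j}$ by $$\rho_{\pm,1}=\phi_{\pm,1\pm1},\qquad \rho_{\pm,j}=\phi_{\pm,j\pm1}-\sum_{\ell=1}^{j-1}\frac{\ell}{j}\,\phi_{\pm,j\pm1-\ell}\,\rho_{\pm,\ell}\quad(j\ge2).$$ *)

(* Defs.v *)
From Stdlib Require Import Reals ZArith Arith Lia Lra.
From Coquelicot Require Export Coquelicot.

Open Scope C_scope.

Definition zseq := Z -> C.

Definition zero_seq : zseq := fun _ => 0.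

Definition Sp (u : zseq) : zseq := fun n => u (n + 1)%Z.
Definition Sm (u : zseq) : zseq := fun n => u (n - 1)%Z.

Definition Jacobi (a b u : zseq) : zseq :=
  fun n => a n * Sp u n + Sm a n * Sm u n + b n * u n.

Definition delta (n : Z) : zseq := fun m => if Z.eq_dec m n then 1 else 0.

Definition CSeries (u : nat -> C) : C :=
  (Series (fun k => Re (u k)), Series (fun k => Im (u k))).

(** Like [Series], [CSeries] and hence [ZSeries] and [l2_inner] are total; below
    they are only used on sequences with finitely many nonzero terms. *)
Definition ZSeries (u : zseq) : C :=
  CSeries (fun k => u (Z.of_nat k)) + CSeries (fun k => u (- Z.of_nat (S k))%Z).

Definition l2_inner (u v : zseq) : C := ZSeries (fun n => Cconj (u n) * v n).

(** [Jacobi a b] preserves finite support, so its powers may be taken on all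
    sequences and then applied to [delta n]. *)
Definition Jacobi_pow (a b : zseq) (l : nat) : zseq -> zseq :=
  Nat.iter l (Jacobi a b).

Definition fhat (a b : zseq) (l : nat) : zseq :=
  fun n => l2_inner (delta n) (Jacobi_pow a b l (delta n)).

Definition ghat (a b : zseq) (l : nat) : zseq :=
  fun n => - 2 * a n * l2_inner (delta (n + 1)%Z) (Jacobi_pow a b l (delta n)).

(** [c 0] is meant to be [1]; this is a hypothesis wherever it matters. *)
Definition fT (c : nat -> C) (a b : zseq) (l : nat) : zseq :=
  fun n => sum_n_m (fun k => c (l - k)%nat * fhat a b k n) 0 l.

Definition gT (c : nat -> C) (a b : zseq) (l : nat) : zseq :=
  fun n => sum_n_m (fun k => c (l - k)%nat * ghat a b k n) 1 l - c (S l).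

(** [cov d step j] is [step j u], where [u i] is [cov d step i] for [i < j].
    The function [u = cov_table d step j] carries no meaningful values at
    indices [i >= j], so [step j] should not consult them. *)
Fixpoint cov_table {A : Type} (d : A) (step : nat -> (nat -> A) -> A) (n : nat)
  : nat -> A :=
  match n with
  | O => fun _ => d
  | S m => fun i => if (i <? m)%nat then cov_table d step m i
                    else step m (cov_table d step m)
  end.

Definition cov {A : Type} (d : A) (step : nat -> (nat -> A) -> A) (j : nat) : A :=
  step j (cov_table d step j).

Lemma cov_table_lt {A : Type} (d : A) step n i :
  (i < n)%nat -> cov_table d step n i = cov d step i.
Proof.
  induction n as [|n IH]; intros H; [lia|].
  simpl. destruct (Nat.ltb_spec i n) as [Hi|Hi].
  - now apply IH.
  - now replace i with n by lia.
Qed.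

Inductive sgn := Plus | Minus.

Definition phi_plus_step (a b : zseq) (j : nat) (u : nat -> zseq) : zseq :=
  fun n =>
  match j with
  | O => 0
  | 1%nat => 1
  | 2%nat => Sp b n
  | S i => Sp b n * u i n
           + Sp a n * Sp a n
             * sum_n_m (fun l => Sp (u (i - l)%nat) n * u l n) 1 (i - 1)
  end.

Definition phi_minus_step (a b : zseq) (j : nat) (u : nat -> zseq) : zseq :=
  fun n =>
  match j with
  | O => - b n
  | 1%nat => - (Sm a n * Sm a n)
  | S i => - b n * Sm (u i) n
           - sum_n_m (fun l => u (i - l)%nat n * Sm (u l) n) 0 i
  end.

(** The index range is [j >= 1] for [Plus] and [j >= -1] for [Minus]; the value
    outside this range is set to [0] and is never used. *)
Definition phi (s : sgn) (a b : zseq) (j : Z) : zseq :=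
  match s with
  | Plus =>
      if (1 <=? j)%Z then cov zero_seq (phi_plus_step a b) (Z.to_nat j)
      else zero_seq
  | Minus =>
      if (0 <=? j)%Z then cov zero_seq (phi_minus_step a b) (Z.to_nat j)
      else if (j =? -1)%Z then fun _ => 1
      else zero_seq
  end.

Definition pm1 (s : sgn) : Z := match s with Plus => 1%Z | Minus => (-1)%Z end.

Definition rho_step (s : sgn) (a b : zseq) (j : nat) (u : nat -> zseq) : zseq :=
  fun n =>
  match j with
  | O => 0
  | 1%nat => phi s a b (1 + pm1 s) n
  | _ => phi s a b (Z.of_nat j + pm1 s) n
         - sum_n_m (fun l => RtoC (INR l / INR j)
                             * phi s a b (Z.of_nat j + pm1 s - Z.of_nat l) n
                             * u l n) 1 (j - 1)
  end.

(** Meaningful for [j >= 1] only. *)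
Definition rho (s : sgn) (a b : zseq) (j : nat) : zseq :=
  cov zero_seq (rho_step s a b) j.

Definition current (s : sgn) (c : nat -> C) (a b : zseq) (p j : nat) : zseq :=
  fun n =>
  match s with
  | Plus =>
      - 2 * (a n * a n)
      * sum_n_m (fun l => fT c a b l n
                          * phi Plus a b (Z.of_nat p + Z.of_nat j - Z.of_nat l) n)
                0 p
  | Minus =>
      - 2
      * sum_n_m (fun l => fT c a b l n
                          * phi Minus a b (Z.of_nat p + Z.of_nat j - Z.of_nat l) n)
                0 p
  end.

Definition at_time (a : Z -> R -> C) (t : R) : zseq := fun n => a n t.

(** Derivative of a complex-valued function of a real variable; the normed
    space is fixed to be [C] over the reals. *)
Definition is_deriv (f : R -> C) (t : R) (l : C) : Prop :=
  @is_derive R_AbsRing C_R_NormedModule f t l.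

Definition C1_complex (f : R -> C) : Prop :=
  exists df : R -> C, forall t : R,
    is_deriv f t (df t) /\ @continuous R_UniformSpace C_UniformSpace df t.

Lemma phi_plus_1 a b n : phi Plus a b 1 n = 1.
Proof. reflexivity. Qed.

Lemma phi_plus_2 a b n : phi Plus a b 2 n = Sp b n.
Proof. reflexivity. Qed.

Lemma phi_plus_rec a b (j : nat) n : (2 <= j)%nat ->
  phi Plus a b (Z.of_nat j + 1) n
  = Sp b n * phi Plus a b (Z.of_nat j) n
    + Sp a n * Sp a n
      * sum_n_m (fun l => Sp (phi Plus a b (Z.of_nat j - Z.of_nat l)) n
                          * phi Plus a b (Z.of_nat l) n) 1 (j - 1).
Proof.
  intros Hj.
  assert (E : forall i : nat, (1 <= i)%nat -> phi Plus a b (Z.of_nat i)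
                = cov zero_seq (phi_plus_step a b) i).
  { intros i Hi. unfold phi. destruct (Z.leb_spec 1 (Z.of_nat i)); [|lia].
    now rewrite Nat2Z.id. }
  replace (Z.of_nat j + 1)%Z with (Z.of_nat (S j)) by lia.
  rewrite !E by lia. destruct j as [|[|j]]; try lia.
  unfold cov at 1; cbn [phi_plus_step].
  rewrite cov_table_lt by lia. apply (f_equal (fun x => _ + _ * x)).
  apply sum_n_m_ext_loc; intros l Hl.
  rewrite !cov_table_lt by lia. rewrite <- Nat2Z.inj_sub by lia.
  now rewrite !E by lia.
Qed.

Lemma phi_minus_m1 a b n : phi Minus a b (-1) n = 1.
Proof. reflexivity. Qed.

Lemma phi_minus_0 a b n : phi Minus a b 0 n = - b n.
Proof. reflexivity. Qed.

Lemma phi_minus_1 a b n : phi Minus a b 1 n = - (Sm a n * Sm a n).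
Proof. reflexivity. Qed.

Lemma phi_minus_rec a b (j : nat) n : (1 <= j)%nat ->
  phi Minus a b (Z.of_nat j + 1) n
  = - b n * Sm (phi Minus a b (Z.of_nat j)) n
    - sum_n_m (fun l => phi Minus a b (Z.of_nat j - Z.of_nat l) n
                        * Sm (phi Minus a b (Z.of_nat l)) n) 0 j.
Proof.
  intros Hj.
  assert (E : forall i : nat, phi Minus a b (Z.of_nat i)
                = cov zero_seq (phi_minus_step a b) i).
  { intros i. unfold phi. destruct (Z.leb_spec 0 (Z.of_nat i)); [|lia].
    now rewrite Nat2Z.id. }
  replace (Z.of_nat j + 1)%Z with (Z.of_nat (S j)) by lia.
  rewrite !E. destruct j as [|j]; try lia.
  unfold cov at 1; cbn [phi_minus_step].
  rewrite cov_table_lt by lia. apply (f_equal (fun x => _ - x)).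
  apply sum_n_m_ext_loc; intros l Hl.
  rewrite !cov_table_lt by lia. rewrite <- Nat2Z.inj_sub by lia.
  now rewrite !E.
Qed.

Lemma rho_1 s a b n : rho s a b 1 n = phi s a b (1 + pm1 s) n.
Proof. reflexivity. Qed.

Lemma rho_rec s a b (j : nat) n : (2 <= j)%nat ->
  rho s a b j n
  = phi s a b (Z.of_nat j + pm1 s) n
    - sum_n_m (fun l => RtoC (INR l / INR j)
                        * phi s a b (Z.of_nat j + pm1 s - Z.of_nat l) n
                        * rho s a b l n) 1 (j - 1).
Proof.
  intros Hj. unfold rho. destruct j as [|[|j]]; try lia.
  unfold cov at 1; cbn [rho_step]. apply (f_equal (fun x => _ - x)).
  apply sum_n_m_ext_loc; intros l Hl.
  now rewrite cov_table_lt by lia.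
Qed.

(* Main.v *)
Require Import Defs.
From Stdlib Require Import Reals ZArith Lia Lra FunctionalExtensionality.
From Coquelicot Require Import Coquelicot.

(** In w = 1/z, the series X = sum_k phi_{±,k±1} w^k is the Riccati solution
    phi_± normalized by phi_± = w a X (plus sign) and phi_± = X/(a w) (minus sign), and
    sum_j rho_{±,j} w^j is its logarithm. With F, G the polynomials sum_{l<=p} f_l w^l,
    sum_{l<=p} g_l w^l, the zero-curvature form of the Toda equation gives
    w^{p+1} X_t = X (S^+ - I) V, where V = 2 a^2 w^2 F X + w G for the plus sign and
    V = 2 F X + w G + 2 f_{p+1} w^{p+1} for the minus sign: both sides satisfy the
    Riccati equation linearized at X, which has a single solution in formal power
    series. Dividing by X gives w^{p+1} (ln X)_t = (S^+ - I) V. The coefficient of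
    w^{p+1+j} for j >= 1 is the conservation law, since G has degree at most p. *)

Open Scope C_scope.

(** * Differential calculus for complex-valued functions of a real variable *)

Lemma is_deriv_components (f : R -> C) (t : R) (l : C) :
  is_deriv f t l <->
  is_derive (fun s => Re (f s)) t (Re l) /\ is_derive (fun s => Im (f s)) t (Im l).
Proof.
  unfold is_deriv, is_derive. split.
  - intros H; split.
    + apply (filterdiff_comp' (V := C_R_NormedModule) (W := R_NormedModule) f
               (fun z => fst z) t _ (fun z => fst z) H).
      apply filterdiff_linear, is_linear_fst.
    + apply (filterdiff_comp' (V := C_R_NormedModule) (W := R_NormedModule) f
               (fun z => snd z) t _ (fun z => snd z) H).
      apply filterdiff_linear, is_linear_snd.
  - intros [H1 H2].
    apply (filterdiff_ext (V := C_R_NormedModule) (fun s => (Re (f s), Im (f s)))).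
    { intros s. now destruct (f s). }
    apply (filterdiff_comp'_2 (W := C_R_NormedModule) _ _ (fun x y => (x, y)) t
             _ _ (fun x y => (x, y)) H1 H2).
    apply filterdiff_linear. split.
    + intros [] []; reflexivity.
    + intros ? []; reflexivity.
    (* The norm of [C_R_NormedModule] is the product norm, so pairing two real numbers is bounded
       with constant 1. *)
    + exists 1%R. split; [lra|]. intros []. rewrite Rmult_1_l. apply Rle_refl.
Qed.

Lemma is_deriv_unique (f : R -> C) (t : R) (l1 l2 : C) :
  is_deriv f t l1 -> is_deriv f t l2 -> l1 = l2.
Proof.
  rewrite !is_deriv_components. intros [H1 H2] [H3 H4].
  apply is_derive_unique in H1, H2, H3, H4.
  destruct l1, l2; simpl in *; congruence.
Qed.

Lemma is_deriv_ext (f g : R -> C) (t : R) (l : C) :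
  (forall s, f s = g s) -> is_deriv f t l -> is_deriv g t l.
Proof. intros E. now rewrite (functional_extensionality f g E). Qed.

Lemma is_deriv_const (x : C) (t : R) : is_deriv (fun _ => x) t 0.
Proof. apply is_deriv_components. split; apply (is_derive_const (V := R_NormedModule)). Qed.

Lemma is_deriv_plus (f g : R -> C) (t : R) (df dg : C) :
  is_deriv f t df -> is_deriv g t dg -> is_deriv (fun s => f s + g s) t (df + dg).
Proof.
  rewrite !is_deriv_components. intros [H1 H2] [H3 H4].
  split; now apply (is_derive_plus (V := R_NormedModule)).
Qed.

Lemma is_deriv_opp (f : R -> C) (t : R) (df : C) :
  is_deriv f t df -> is_deriv (fun s => - f s) t (- df).
Proof.
  rewrite !is_deriv_components. intros [H1 H2].
  split; now apply (is_derive_opp (V := R_NormedModule)).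
Qed.

Lemma is_deriv_mult (f g : R -> C) (t : R) (df dg : C) :
  is_deriv f t df -> is_deriv g t dg ->
  is_deriv (fun s => f s * g s) t (df * g t + f t * dg).
Proof.
  rewrite !is_deriv_components. intros [H1 H2] [H3 H4]. unfold Re, Im in *. split.
  - refine (eq_rect _ (is_derive _ t)
              (is_derive_minus (V := R_NormedModule) _ _ _ _ _
                 (Derive.is_derive_mult _ _ _ _ _ H1 H3)
                 (Derive.is_derive_mult _ _ _ _ _ H2 H4)) _ _).
    unfold minus, plus, opp; simpl. ring.
  - refine (eq_rect _ (is_derive _ t)
              (is_derive_plus (V := R_NormedModule) _ _ _ _ _
                 (Derive.is_derive_mult _ _ _ _ _ H1 H4)
                 (Derive.is_derive_mult _ _ _ _ _ H2 H3)) _ _).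
    unfold plus; simpl. ring.
Qed.

Definition ex_deriv (f : R -> C) (t : R) : Prop := exists l, is_deriv f t l.

Lemma ex_deriv_sum (f : nat -> R -> C) (t : R) (m n : nat) :
  (forall i, (m <= i <= n)%nat -> ex_deriv (f i) t) ->
  ex_deriv (fun s => sum_n_m (fun i => f i s) m n) t.
Proof.
  intros H. destruct (Nat.lt_ge_cases n m) as [Hnm|Hmn].
  - exists 0. apply is_deriv_ext with (fun _ => 0); [|apply is_deriv_const].
    intros s. now rewrite sum_n_m_zero.
  - induction Hmn as [|n Hmn IH].
    + destruct (H m) as [l Hl]; [lia|]. exists l.
      apply is_deriv_ext with (f m); [|exact Hl]. intros s. now rewrite sum_n_n.
    + destruct IH as [l1 H1]; [intros i Hi; apply H; lia|].
      destruct (H (S n)) as [l2 H2]; [lia|]. exists (l1 + l2).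
      eapply is_deriv_ext; [|exact (is_deriv_plus _ _ _ _ _ H1 H2)].
      intros s. symmetry. apply (sum_n_Sm (G := C_AbelianMonoid)). lia.
Qed.

Lemma ex_deriv_plus (f g : R -> C) (t : R) :
  ex_deriv f t -> ex_deriv g t -> ex_deriv (fun s => f s + g s) t.
Proof. intros [] []. eexists. eapply is_deriv_plus; eassumption. Qed.

Lemma ex_deriv_opp (f : R -> C) (t : R) : ex_deriv f t -> ex_deriv (fun s => - f s) t.
Proof. intros []. eexists. eapply is_deriv_opp; eassumption. Qed.

Lemma ex_deriv_mult (f g : R -> C) (t : R) :
  ex_deriv f t -> ex_deriv g t -> ex_deriv (fun s => f s * g s) t.
Proof. intros [] []. eexists. eapply is_deriv_mult; eassumption. Qed.

Lemma ex_deriv_const (x : C) (t : R) : ex_deriv (fun _ => x) t.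
Proof. eexists. apply is_deriv_const. Qed.

(** * The ring of formal power series in w over the complex numbers *)

Local Notation ps := (nat -> C).

Declare Scope ps_scope.
Delimit Scope ps_scope with ps.

(** The monomial x w^m. With m = 0 it embeds constants, so that scalars such as a^2 and b can take
    part in [ring] computations on series. *)
Definition ps_mono (m : nat) (x : C) : ps := fun k => if (k =? m)%nat then x else 0.
Definition ps_add (u v : ps) : ps := fun k => u k + v k.
Definition ps_opp (u : ps) : ps := fun k => - u k.

(** The Cauchy product, by recursion on the tail of u instead of a finite sum: the ring laws then
    follow by induction on k without reindexing. [ps_mul_sum] recovers the usual formula. *)
Fixpoint ps_mul (u v : ps) (k : nat) : C :=
  match k with
  | O => u O * v O
  | S k' => u O * v (S k') + ps_mul (fun i => u (S i)) v k'
  end.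

Local Notation ps_zero := (fun _ : nat => RtoC 0%R).
Local Notation ps_one := (ps_mono 0 1).
Local Notation ps_w := (ps_mono 1 1).

Infix "+" := ps_add : ps_scope.
Infix "*" := ps_mul : ps_scope.
Local Notation "- u" := (ps_opp u) : ps_scope.
Local Notation "u - v" := (ps_add u (ps_opp v)) : ps_scope.

Lemma ps_mul_0_l (v : ps) (k : nat) : ps_mul ps_zero v k = 0.
Proof. induction k as [|k IH]; simpl; [ring|]. rewrite IH. ring. Qed.

Lemma ps_mul_ext (u u' v v' : ps) (k : nat) :
  (forall i, (i <= k)%nat -> u i = u' i) -> (forall i, (i <= k)%nat -> v i = v' i) ->
  ps_mul u v k = ps_mul u' v' k.
Proof.
  revert u u'. induction k as [|k IH]; intros u u' Hu Hv; simpl.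
  - now rewrite Hu, Hv by lia.
  - rewrite Hu, Hv by lia. f_equal. apply IH; intros; [apply Hu|apply Hv]; lia.
Qed.

Lemma ps_mul_S_r (u v : ps) (k : nat) :
  ps_mul u v (S k) = ps_mul u (fun i => v (S i)) k + u (S k) * v O.
Proof.
  revert u. induction k as [|k IH]; intros u; [reflexivity|].
  change (ps_mul u v (S (S k)))
    with (u O * v (S (S k)) + ps_mul (fun i => u (S i)) v (S k)).
  rewrite IH. simpl. ring.
Qed.

Lemma ps_mul_comm_coef (u v : ps) (k : nat) : ps_mul u v k = ps_mul v u k.
Proof.
  revert u v. induction k as [|k IH]; intros u v; [simpl; ring|].
  rewrite ps_mul_S_r. simpl. rewrite IH. ring.
Qed.

Lemma ps_mul_add_l (u v z : ps) (k : nat) :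
  ps_mul (ps_add u v) z k = ps_mul u z k + ps_mul v z k.
Proof.
  revert u v. induction k as [|k IH]; intros u v; [simpl; unfold ps_add; ring|].
  simpl. change (fun i => ps_add u v (S i))
    with (ps_add (fun i => u (S i)) (fun i => v (S i))).
  rewrite IH. unfold ps_add. ring.
Qed.

Lemma ps_mul_scal_l (x : C) (u v : ps) (k : nat) :
  ps_mul (fun i => x * u i) v k = x * ps_mul u v k.
Proof.
  revert u. induction k as [|k IH]; intros u; simpl; [ring|].
  rewrite (IH (fun i => u (S i))). ring.
Qed.

Lemma ps_mul_assoc_coef (u v z : ps) (k : nat) :
  ps_mul u (ps_mul v z) k = ps_mul (ps_mul u v) z k.
Proof.
  revert u. induction k as [|k IH]; intros u; [simpl; ring|].
  cbn [ps_mul]. rewrite IH.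
  change (fun i => u O * v (S i) + ps_mul (fun j => u (S j)) v i)
    with (ps_add (fun i => u O * v (S i)) (ps_mul (fun i => u (S i)) v)).
  rewrite ps_mul_add_l, ps_mul_scal_l. ring.
Qed.

Lemma ps_mul_mono (m : nat) (x : C) (u : ps) (k : nat) :
  ps_mul (ps_mono m x) u k = if (k <? m)%nat then 0 else x * u (k - m)%nat.
Proof.
  revert k. induction m as [|m IH]; intros [|k].
  - reflexivity.
  - simpl. change (fun i => ps_mono 0 x (S i)) with ps_zero.
    rewrite ps_mul_0_l. unfold ps_mono. simpl. ring.
  - simpl. unfold ps_mono. simpl. ring.
  - simpl. change (fun i => ps_mono (S m) x (S i)) with (ps_mono m x).
    rewrite IH. change (S k <? S m)%nat with (k <? m)%nat.
    unfold ps_mono. simpl. ring.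
Qed.

(** Series are compared by Leibniz equality, obtained from functional extensionality, so that [ring]
    and [rewrite] act on whole series and not coefficient by coefficient. *)
Lemma ps_ring_theory :
  @ring_theory ps ps_zero ps_one ps_add ps_mul (fun u v => ps_add u (ps_opp v)) ps_opp eq.
Proof.
  split; intros; apply functional_extensionality; intros k.
  - unfold ps_add. ring.
  - unfold ps_add. ring.
  - unfold ps_add. ring.
  - rewrite ps_mul_mono. simpl. rewrite Nat.sub_0_r. ring.
  - apply ps_mul_comm_coef.
  - apply ps_mul_assoc_coef.
  - rewrite ps_mul_add_l. reflexivity.
  - reflexivity.
  - unfold ps_add, ps_opp. ring.
Qed.

Add Ring ps_ring : ps_ring_theory.

Lemma ps_mul_sum (u v : ps) (k : nat) :
  ps_mul u v k = sum_n_m (fun i => u i * v (k - i)%nat) 0 k.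
Proof.
  revert u. induction k as [|k IH]; intros u.
  - now rewrite sum_n_n.
  - rewrite sum_Sn_m by lia. rewrite <- sum_n_m_S. simpl. now rewrite IH.
Qed.

Lemma ps_mul_lowest (u v : ps) (k : nat) :
  (forall i, (i < k)%nat -> v i = 0) -> ps_mul u v k = u O * v k.
Proof.
  intros H. destruct k as [|k]; [reflexivity|]. simpl.
  rewrite (ps_mul_ext _ (fun i => u (S i)) _ ps_zero k), ps_mul_comm_coef, ps_mul_0_l;
    [ring|reflexivity|].
  intros i Hi. apply H. lia.
Qed.

(** The uniqueness principle for linear difference equations in formal power series. If all D n
    vanish below order k, the coefficient of w^k in the equation reads D n k = 0, because A has
    constant term 1 and B has none. The induction is uniform in n, since the equation couples n with
    sigma n. *)
Lemma ps_shift_eq_zero {I : Type} (sigma : I -> I) (A B D : I -> ps) :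
  (forall n, A n O = 1) -> (forall n, B n O = 0) ->
  (forall n, ps_mul (A n) (D n) = ps_mul (B n) (D (sigma n))) ->
  forall n, D n = ps_zero.
Proof.
  intros HA HB H n. apply functional_extensionality. intros k. revert n.
  induction k as [k IH] using lt_wf_ind. intros n.
  assert (E := f_equal (fun u => u k) (H n)). simpl in E.
  rewrite !ps_mul_lowest, HA, HB in E by (intros i Hi; now apply IH).
  rewrite <- (Cmult_1_l (D n k)), E. ring.
Qed.

Lemma ps_mul_cancel (x u v : ps) : x O = 1 -> ps_mul x u = ps_mul x v -> u = v.
Proof.
  intros Hx H.
  (* The uniqueness principle on a one-point index set with B = 0. *)
  assert (E : (u - v)%ps = ps_zero).
  { apply (ps_shift_eq_zero (fun i : unit => i) (fun _ => x) (fun _ => ps_zero)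
             (fun _ => (u - v)%ps)); [now intros|now intros|intros _|exact tt].
    transitivity (x * u - x * v)%ps; [ring|]. rewrite H. ring. }
  transitivity (u - v + v)%ps; [ring|]. rewrite E. ring.
Qed.

(** * The Euler operator w d/dw, time derivatives of series, and logarithmic derivatives *)

Definition ps_theta (u : ps) : ps := fun k => INR k * u k.

Lemma ps_theta_mul (u v : ps) :
  ps_theta (u * v)%ps = (ps_theta u * v + u * ps_theta v)%ps.
Proof.
  apply functional_extensionality. intros k. revert u.
  induction k as [|k IH]; intros u.
  - unfold ps_theta, ps_add. simpl. ring.
  - assert (E := IH (fun i => u (S i))). unfold ps_theta, ps_add in E.
    unfold ps_theta at 1, ps_add. cbn [ps_mul].
    change (fun i => ps_theta u (S i)) with (fun i => INR (S i) * u (S i)).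
    (* On the tail the weight is i + 1, so it contributes its own Euler derivative plus itself. *)
    replace (fun i => INR (S i) * u (S i))
      with (ps_add (fun i => INR i * u (S i)) (fun i => u (S i))).
    2:{ apply functional_extensionality. intros i. unfold ps_add.
        rewrite S_INR, RtoC_plus. ring. }
    rewrite ps_mul_add_l. unfold ps_theta. change (INR 0) with 0%R.
    rewrite S_INR, RtoC_plus.
    transitivity ((INR k + 1) * (u O * v (S k))
                  + INR k * ps_mul (fun i => u (S i)) v k
                  + ps_mul (fun i => u (S i)) v k); [ring|].
    rewrite E. ring.
Qed.

(** Coefficientwise in time; since every coefficient of a product is a finite sum, no convergence in
    w is involved. *)
Definition ps_deriv (u : R -> ps) (t : R) (du : ps) : Prop :=
  forall k, is_deriv (fun s => u s k) t (du k).

Lemma ps_deriv_unique (u : R -> ps) (t : R) (d1 d2 : ps) :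
  ps_deriv u t d1 -> ps_deriv u t d2 -> d1 = d2.
Proof.
  intros H1 H2. apply functional_extensionality. intros k.
  exact (is_deriv_unique _ _ _ _ (H1 k) (H2 k)).
Qed.

Lemma ps_deriv_const (u : ps) (t : R) : ps_deriv (fun _ => u) t ps_zero.
Proof. intros k. apply is_deriv_const. Qed.

Lemma ps_deriv_mono (m : nat) (f : R -> C) (t : R) (l : C) :
  is_deriv f t l -> ps_deriv (fun s => ps_mono m (f s)) t (ps_mono m l).
Proof.
  intros H k. unfold ps_mono. destruct (k =? m)%nat; [exact H|apply is_deriv_const].
Qed.

Lemma ps_deriv_add (u v : R -> ps) (t : R) (du dv : ps) :
  ps_deriv u t du -> ps_deriv v t dv ->
  ps_deriv (fun s => u s + v s)%ps t (du + dv)%ps.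
Proof. intros Hu Hv k. exact (is_deriv_plus _ _ _ _ _ (Hu k) (Hv k)). Qed.

Lemma ps_deriv_opp (u : R -> ps) (t : R) (du : ps) :
  ps_deriv u t du -> ps_deriv (fun s => - u s)%ps t (- du)%ps.
Proof. intros Hu k. exact (is_deriv_opp _ _ _ (Hu k)). Qed.

Lemma ps_deriv_mul (u v : R -> ps) (t : R) (du dv : ps) :
  ps_deriv u t du -> ps_deriv v t dv ->
  ps_deriv (fun s => u s * v s)%ps t (du * v t + u t * dv)%ps.
Proof.
  intros Hu Hv k. revert u du Hu. induction k as [|k IH]; intros u du Hu.
  - exact (is_deriv_mult _ _ _ _ _ (Hu O) (Hv O)).
  - assert (H1 := IH (fun s i => u s (S i)) (fun i => du (S i)) (fun i => Hu (S i))).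
    assert (H2 := is_deriv_plus _ _ _ _ _
                    (is_deriv_mult _ _ _ _ _ (Hu O) (Hv (S k))) H1).
    refine (eq_rect _ (is_deriv _ t) H2 _ _).
    unfold ps_add. simpl. ring.
Qed.

Lemma ps_deriv_theta (u : R -> ps) (t : R) (du : ps) :
  ps_deriv u t du -> ps_deriv (fun s => ps_theta (u s)) t (ps_theta du).
Proof.
  intros Hu k.
  refine (eq_rect _ (is_deriv _ t)
            (is_deriv_mult _ _ _ _ _ (is_deriv_const (INR k) t) (Hu k)) _ _).
  unfold ps_theta. ring.
Qed.

(** The relation [Hlog] says r = ln x without a division or a logarithm series. Differentiating it
    in time shows that e = dx - x dr satisfies theta e = (theta r) e. As theta r has no constant
    term, the coefficient of w^k gives k e_k = 0 once the lower coefficients of e vanish; for k = 0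
    the constant terms of x and r do not depend on time. *)
Lemma ps_log_deriv (x r : R -> ps) (t : R) (dx dr : ps) :
  (forall s, x s O = 1) -> (forall s, r s O = 0) ->
  (forall s, ps_theta (x s) = (x s * ps_theta (r s))%ps) ->
  ps_deriv x t dx -> ps_deriv r t dr -> dx = (x t * dr)%ps.
Proof.
  intros Hx Hr Hlog Dx Dr.
  assert (Hdx : dx O = 0).
  { apply (is_deriv_unique (fun s => x s O) t); [apply Dx|].
    eapply is_deriv_ext; [|apply (is_deriv_const 1)]. now intros. }
  assert (Hdr : dr O = 0).
  { apply (is_deriv_unique (fun s => r s O) t); [apply Dr|].
    eapply is_deriv_ext; [|apply (is_deriv_const 0)]. now intros. }
  assert (E : ps_theta dx = (dx * ps_theta (r t) + x t * ps_theta dr)%ps).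
  { apply (ps_deriv_unique (fun s => ps_theta (x s)) t).
    - now apply ps_deriv_theta.
    - rewrite (functional_extensionality _ _ Hlog).
      apply ps_deriv_mul; [|apply ps_deriv_theta]; assumption. }
  set (e := (dx - x t * dr)%ps).
  assert (He : ps_theta e = (ps_theta (r t) * e)%ps).
  { transitivity (ps_theta dx - ps_theta (x t * dr)%ps)%ps.
    - apply functional_extensionality. intros k.
      unfold e, ps_theta, ps_add, ps_opp. ring.
    - rewrite ps_theta_mul, E, Hlog. unfold e. ring. }
  assert (Z : forall k, e k = 0).
  { intros k. induction k as [[|k] IH] using lt_wf_ind.
    - unfold e, ps_add, ps_opp. simpl. rewrite Hdx, Hdr. ring.
    - assert (Ek := f_equal (fun u => u (S k)) He). cbv beta in Ek.
      rewrite (ps_mul_lowest _ e (S k) IH) in Ek.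
      unfold ps_theta at 2 in Ek. rewrite Hr in Ek. unfold ps_theta in Ek.
      apply (f_equal (Cmult (/ INR (S k)))) in Ek.
      rewrite Cmult_assoc, Cinv_l, Cmult_1_l in Ek.
      + rewrite Ek. ring.
      + intros A. apply RtoC_inj in A. now apply not_0_INR in A. }
  transitivity (e + x t * dr)%ps; [unfold e; ring|].
  rewrite (functional_extensionality e _ Z). ring.
Qed.

(** * Matrix elements of powers of L and the homogeneous recursion *)

Lemma Series_single (u : nat -> R) (m : nat) :
  (forall k, k <> m -> u k = 0%R) -> Series u = u m.
Proof.
  intros H. apply is_series_unique.
  assert (E : forall N, sum_n u N = if (m <=? N)%nat then u m else 0%R).
  { intros N. induction N as [|N IH].
    - rewrite sum_O. destruct (Nat.leb_spec m 0); [f_equal; lia|apply H; lia].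
    - rewrite sum_Sn, IH. unfold plus; simpl.
      destruct (Nat.leb_spec m N); destruct (Nat.leb_spec m (S N)); try lia.
      + rewrite (H (S N)) by lia. ring.
      + replace m with (S N) by lia. ring.
      + rewrite H by lia. ring. }
  apply (filterlim_ext_loc (fun _ => u m)).
  - exists m. intros N HN. rewrite E. destruct (Nat.leb_spec m N); [easy|lia].
  - apply filterlim_const.
Qed.

Lemma CSeries_single (u : nat -> C) (m : nat) :
  (forall k, k <> m -> u k = 0) -> CSeries u = u m.
Proof.
  intros H. unfold CSeries. rewrite !(Series_single _ m).
  - now destruct (u m).
  - intros k Hk. now rewrite H.
  - intros k Hk. now rewrite H.
Qed.

Lemma ZSeries_single (u : zseq) (m : Z) :
  (forall k, k <> m -> u k = 0) -> ZSeries u = u m.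
Proof.
  intros H. unfold ZSeries. destruct (Z_le_gt_dec 0 m) as [Hm|Hm].
  - rewrite (CSeries_single _ (Z.to_nat m)) by (intros; apply H; lia).
    (* On the half-line that misses m every term is zero, so any index, here 0, may serve as the
       exceptional one. *)
    rewrite (CSeries_single _ O) by (intros; apply H; lia).
    rewrite (H (- Z.of_nat 1)%Z) by lia. rewrite Z2Nat.id by lia. ring.
  - rewrite (CSeries_single _ O) by (intros; apply H; lia).
    rewrite (CSeries_single _ (Z.to_nat (- m - 1))) by (intros; apply H; lia).
    rewrite (H (Z.of_nat 0)) by lia.
    replace (- Z.of_nat (S (Z.to_nat (- m - 1))))%Z with m by lia. ring.
Qed.

Lemma delta_same (n : Z) : delta n n = 1.
Proof. unfold delta. now destruct (Z.eq_dec n n). Qed.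

Lemma delta_other (n m : Z) : m <> n -> delta n m = 0.
Proof. intros H. unfold delta. now destruct (Z.eq_dec m n). Qed.

Lemma l2_inner_delta (n : Z) (v : zseq) : l2_inner (delta n) v = v n.
Proof.
  unfold l2_inner. rewrite (ZSeries_single _ n).
  - rewrite delta_same. apply injective_projections; simpl; ring.
  - intros k Hk. rewrite delta_other by exact Hk.
    apply injective_projections; simpl; ring.
Qed.

Lemma Jacobi_pow_S (a b : zseq) (l : nat) (m n : Z) :
  Jacobi_pow a b (S l) (delta n) m
  = a m * Jacobi_pow a b l (delta n) (m + 1)%Z
    + a (m - 1)%Z * Jacobi_pow a b l (delta n) (m - 1)%Z
    + b m * Jacobi_pow a b l (delta n) m.
Proof. reflexivity. Qed.

(** This is L^(l+1) delta_n = L^l (L delta_n) with L delta_n = a(n) delta_(n+1) + a(n-1) delta_(n-1)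
    + b(n) delta_n: the expansion at the source, where [Jacobi_pow_S] expands at the target. *)
Lemma Jacobi_pow_S_source (a b : zseq) (l : nat) (m n : Z) :
  Jacobi_pow a b (S l) (delta n) m
  = a n * Jacobi_pow a b l (delta (n + 1)%Z) m
    + a (n - 1)%Z * Jacobi_pow a b l (delta (n - 1)%Z) m
    + b n * Jacobi_pow a b l (delta n) m.
Proof.
  revert m n. induction l as [|l IH]; intros m n.
  - rewrite Jacobi_pow_S. unfold Jacobi_pow; simpl.
    destruct (Z.eq_dec m n) as [->|H0];
      [|destruct (Z.eq_dec m (n + 1)) as [->|H1];
        [|destruct (Z.eq_dec m (n - 1)) as [->|H2]]].
    + rewrite delta_same, !delta_other by lia. ring.
    + replace (n + 1 - 1)%Z with n by lia.
      rewrite !delta_same, !delta_other by lia. ring.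
    + replace (n - 1 + 1)%Z with n by lia.
      rewrite !delta_same, !delta_other by lia. ring.
    + rewrite !delta_other by lia. ring.
  - rewrite (Jacobi_pow_S a b (S l)), (IH (m + 1)%Z), (IH (m - 1)%Z).
    rewrite (Jacobi_pow_S a b l m (n + 1)%Z), (Jacobi_pow_S a b l m (n - 1)%Z).
    rewrite (IH m n) at 1. rewrite (Jacobi_pow_S a b l m n). ring.
Qed.

(** The matrix of L is symmetric, though for complex a and b not Hermitian. Expanding one side at
    the target and the other at the source gives the same three terms. *)
Lemma Jacobi_pow_sym (a b : zseq) (l : nat) (m n : Z) :
  Jacobi_pow a b l (delta n) m = Jacobi_pow a b l (delta m) n.
Proof.
  revert m n. induction l as [|l IH]; intros m n.
  - unfold Jacobi_pow; simpl. destruct (Z.eq_dec m n) as [->|H]; [easy|].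
    rewrite !delta_other by lia. reflexivity.
  - rewrite Jacobi_pow_S, Jacobi_pow_S_source.
    rewrite (IH (m + 1)%Z), (IH (m - 1)%Z), (IH m). reflexivity.
Qed.

Lemma fhat_0 (a b : zseq) (n : Z) : fhat a b 0 n = 1.
Proof. unfold fhat. rewrite l2_inner_delta. apply delta_same. Qed.

Lemma ghat_0 (a b : zseq) (n : Z) : ghat a b 0 n = 0.
Proof.
  unfold ghat. rewrite l2_inner_delta. unfold Jacobi_pow; simpl.
  rewrite delta_other by lia. ring.
Qed.

(** Expanding the outer factor L produces the neighbours n + 1 and n - 1 of the target; symmetry
    turns the second one into the matrix element of [ghat] at n - 1. *)
Lemma fhat_S (a b : zseq) (l : nat) (n : Z) :
  2 * fhat a b (S l) n + ghat a b l n + ghat a b l (n - 1)%Z - 2 * b n * fhat a b l n = 0.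
Proof.
  unfold fhat, ghat. rewrite !l2_inner_delta, Jacobi_pow_S.
  replace (n - 1 + 1)%Z with n by lia.
  rewrite (Jacobi_pow_sym a b l (n - 1)%Z n). ring.
Qed.

(** Both matrix elements are expanded at the site n, which is the source in the first and the target
    in the second. The cross terms a(n) a(n-1) (L^l delta_(n-1))(n+1) then cancel. *)
Lemma ghat_S (a b : zseq) (l : nat) (n : Z) :
  ghat a b (S l) n - ghat a b (S l) (n - 1)%Z
  + 2 * (a n * a n * fhat a b l (n + 1)%Z
         - a (n - 1)%Z * a (n - 1)%Z * fhat a b l (n - 1)%Z)
  - b n * (ghat a b l n - ghat a b l (n - 1)%Z) = 0.
Proof.
  unfold fhat, ghat. rewrite !l2_inner_delta.
  rewrite Jacobi_pow_S_source.
  replace (n - 1 + 1)%Z with n by lia. rewrite (Jacobi_pow_S a b l n). ring.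
Qed.

Lemma fT_ps_mul (c : nat -> C) (a b : zseq) (l : nat) (n : Z) :
  fT c a b l n = ps_mul c (fun k => fhat a b k n) l.
Proof.
  rewrite ps_mul_comm_coef, ps_mul_sum. unfold fT.
  apply sum_n_m_ext. intros k. apply Cmult_comm.
Qed.

Lemma gT_ps_mul (c : nat -> C) (a b : zseq) (l : nat) (n : Z) :
  gT c a b l n = ps_mul c (fun k => ghat a b k n) l - c (S l).
Proof.
  rewrite ps_mul_comm_coef, ps_mul_sum. unfold gT.
  (* The sum in [gT] starts at k = 1; the convolution has one more term, which is zero because
     [ghat] vanishes at order 0. *)
  rewrite (sum_Sn_m _ 0) by lia. rewrite ghat_0. unfold plus; simpl.
  transitivity (0 * c (l - 0)%nat
    + sum_n_m (fun k => c (l - k)%nat * ghat a b k n) 1 l - c (S l)); [ring|].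
  do 2 f_equal. apply sum_n_m_ext. intros k. apply Cmult_comm.
Qed.

(** * Generating series of f and g, their recursions, and the truncation at degree p *)

Definition f_ser (c : nat -> C) (a b : zseq) (n : Z) : ps := fun l => fT c a b l n.
Definition g_ser (c : nat -> C) (a b : zseq) (n : Z) : ps := fun l => gT c a b l n.

Local Notation ps_two := (ps_mono 0 2).

(** The homogeneous recursion multiplied by the series c leaves the extra term 2(c - 1). It is
    cancelled by the two constants -c_(l+1) in g(n) and g(n-1), because the series of c_(l+1)
    w^(l+1) is c - 1 when c_0 = 1. *)
Lemma f_ser_rec (c : nat -> C) (hc0 : c O = 1) (a b : zseq) (n : Z) :
  (ps_two * (f_ser c a b n - ps_one)
   + ps_w * (g_ser c a b n + g_ser c a b (n - 1)%Z)
   - ps_w * (ps_two * (ps_mono 0 (b n) * f_ser c a b n)))%ps = ps_zero.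
Proof.
  set (fh := fun k => fhat a b k n). set (gh := fun k => ghat a b k n).
  set (gh' := fun k => ghat a b k (n - 1)%Z).
  assert (Hf : f_ser c a b n = (c * fh)%ps).
  { apply functional_extensionality. intros k. apply fT_ps_mul. }
  assert (Hg : forall m, g_ser c a b m
             = (c * (fun k => ghat a b k m) - (fun k => c (S k)))%ps).
  { intros m. apply functional_extensionality. intros k. apply gT_ps_mul. }
  assert (Hc : (ps_w * (fun k => c (S k)))%ps = (c - ps_one)%ps).
  { apply functional_extensionality. intros [|k]; rewrite ps_mul_mono;
      unfold ps_add, ps_opp, ps_mono; simpl.
    - rewrite hc0. ring.
    - rewrite Nat.sub_0_r. ring. }
  assert (Hhat : (ps_two * (fh - ps_one) + ps_w * (gh + gh')
                  - ps_w * (ps_two * (ps_mono 0 (b n) * fh)))%ps = ps_zero).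
  { apply functional_extensionality. intros k. unfold ps_add, ps_opp.
    rewrite !ps_mul_mono. destruct k as [|k]; simpl.
    - unfold fh, ps_mono. simpl. rewrite fhat_0. ring.
    - rewrite !Nat.sub_0_r. rewrite <- (fhat_S a b k n).
      unfold fh, gh, gh', ps_mono; simpl. ring. }
  assert (H2 : (ps_two = ps_one + ps_one)%ps).
  { apply functional_extensionality. intros [|k]; unfold ps_add, ps_mono; simpl; [|ring].
    apply injective_projections; simpl; ring. }
  rewrite !Hg, Hf. fold gh gh'.
  transitivity (c * (ps_two * (fh - ps_one) + ps_w * (gh + gh')
                     - ps_w * (ps_two * (ps_mono 0 (b n) * fh)))
     + ps_two * (c - ps_one) - (ps_one + ps_one) * (ps_w * (fun k => c (S k))))%ps; [ring|].
  rewrite Hhat, Hc, H2. ring.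
Qed.

(** The summation constants drop out of the differences of g, so this is c times the homogeneous
    recursion. *)
Lemma g_ser_rec (c : nat -> C) (a b : zseq) (n : Z) :
  (g_ser c a b n - g_ser c a b (n - 1)%Z
   + ps_w * (ps_two * (ps_mono 0 (a n * a n) * f_ser c a b (n + 1)%Z
              - ps_mono 0 (a (n - 1)%Z * a (n - 1)%Z) * f_ser c a b (n - 1)%Z))
   - ps_w * (ps_mono 0 (b n) * (g_ser c a b n - g_ser c a b (n - 1)%Z)))%ps = ps_zero.
Proof.
  set (fh := fun m k => fhat a b k m). set (gh := fun m k => ghat a b k m).
  assert (Hf : forall m, f_ser c a b m = (c * fh m)%ps).
  { intros m. apply functional_extensionality. intros k. apply fT_ps_mul. }
  assert (Hg : forall m, g_ser c a b m = (c * gh m - (fun k => c (S k)))%ps).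
  { intros m. apply functional_extensionality. intros k. apply gT_ps_mul. }
  assert (Hhat : (gh n - gh (n - 1)%Z
     + ps_w * (ps_two * (ps_mono 0 (a n * a n) * fh (n + 1)%Z
                - ps_mono 0 (a (n - 1)%Z * a (n - 1)%Z) * fh (n - 1)%Z))
     - ps_w * (ps_mono 0 (b n) * (gh n - gh (n - 1)%Z)))%ps = ps_zero).
  { apply functional_extensionality. intros k. unfold ps_add, ps_opp.
    rewrite !ps_mul_mono. destruct k as [|k]; simpl.
    - unfold gh. rewrite !ghat_0. ring.
    - rewrite !Nat.sub_0_r.
      rewrite <- (ghat_S a b k n). unfold fh, gh; simpl. ring. }
  rewrite !Hg, !Hf.
  transitivity (c * (gh n - gh (n - 1)%Z
     + ps_w * (ps_two * (ps_mono 0 (a n * a n) * fh (n + 1)%Z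
                - ps_mono 0 (a (n - 1)%Z * a (n - 1)%Z) * fh (n - 1)%Z))
     - ps_w * (ps_mono 0 (b n) * (gh n - gh (n - 1)%Z))))%ps; [ring|].
  rewrite Hhat. ring.
Qed.

Lemma C_eq_by_diff (e x y : C) : e = 0 -> x - y = e -> x = y.
Proof. intros He H. transitivity (x - y + y); [ring|]. rewrite H, He. ring. Qed.

Lemma C_eq_by_diff_opp (e x y : C) : e = 0 -> y - x = e -> x = y.
Proof. intros He H. symmetry. exact (C_eq_by_diff e y x He H). Qed.

Definition ps_trunc (p : nat) (u : ps) : ps := fun k => if (k <=? p)%nat then u k else 0.

(** Cutting the series at degree p preserves the recursion in degrees at most p and makes it trivial
    above p + 1. The only defect sits in degree p + 1, where the term 2 f_(p+1) is missing. *)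
Lemma f_trunc_rec (p : nat) (c : nat -> C) (hc0 : c O = 1) (a b : zseq) (n : Z) :
  let F := ps_trunc p (f_ser c a b n) in
  let G m := ps_trunc p (g_ser c a b m) in
  (ps_mono (S p) (2 * fT c a b (S p) n)
   = ps_two - ps_two * F - ps_w * (G n + G (n - 1)%Z)
     + ps_w * (ps_two * (ps_mono 0 (b n) * F)))%ps.
Proof.
  intros F G. apply functional_extensionality. intros k.
  assert (H := f_equal (fun u => u k) (f_ser_rec c hc0 a b n)). cbv beta in H.
  unfold ps_add, ps_opp in *. rewrite !ps_mul_mono in *.
  unfold F, G, ps_trunc, ps_mono, f_ser, g_ser in *.
  destruct k as [|k].
  - simpl in *. apply (C_eq_by_diff _ _ _ H). ring.
  - change (S k <? 1)%nat with false in *. change (?m <? 0)%nat with false in *.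
    change (S k =? S p)%nat with (k =? p)%nat in *.
    cbv iota in *. rewrite ?Nat.sub_0_r in *.
    replace (S k - 1)%nat with k in * by lia. rewrite ?Nat.sub_0_r in *.
    change (S k =? 0)%nat with false in *. cbv iota in *.
    destruct (Nat.leb_spec k p) as [Hk|Hk]; [destruct (Nat.eqb_spec k p) as [->|Hkp]|].
    + destruct (Nat.leb_spec (S p) p); [lia|].
      apply (C_eq_by_diff _ _ _ H). ring.
    + destruct (Nat.leb_spec (S k) p); [|lia].
      apply (C_eq_by_diff _ _ _ H). ring.
    + destruct (Nat.leb_spec (S k) p); [lia|].
      destruct (Nat.eqb_spec k p); [lia|]. ring.
Qed.

(** Again the only defect is in degree p + 1; it is the right-hand side of the Toda equation for
    b. *)
Lemma g_trunc_rec (p : nat) (c : nat -> C) (a b : zseq) (n : Z) :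
  let F m := ps_trunc p (f_ser c a b m) in
  let G m := ps_trunc p (g_ser c a b m) in
  (ps_mono (S p) (- (gT c a b (S p) n - gT c a b (S p) (n - 1)%Z))
   = G n - G (n - 1)%Z - ps_w * (ps_mono 0 (b n) * (G n - G (n - 1)%Z))
     + ps_w * (ps_two * (ps_mono 0 (a n * a n) * F (n + 1)%Z
                - ps_mono 0 (a (n - 1)%Z * a (n - 1)%Z) * F (n - 1)%Z)))%ps.
Proof.
  intros F G. apply functional_extensionality. intros k.
  assert (H := f_equal (fun u => u k) (g_ser_rec c a b n)). cbv beta in H.
  unfold ps_add, ps_opp in *. rewrite !ps_mul_mono in *.
  unfold F, G, ps_trunc, ps_mono, f_ser, g_ser in *.
  destruct k as [|k].
  - simpl in *. apply (C_eq_by_diff_opp _ _ _ H). ring.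
  - change (S k <? 1)%nat with false in *. change (?m <? 0)%nat with false in *.
    change (S k =? S p)%nat with (k =? p)%nat in *.
    cbv iota in *. rewrite ?Nat.sub_0_r in *.
    replace (S k - 1)%nat with k in * by lia. rewrite ?Nat.sub_0_r in *.
    destruct (Nat.leb_spec k p) as [Hk|Hk]; [destruct (Nat.eqb_spec k p) as [->|Hkp]|].
    + destruct (Nat.leb_spec (S p) p); [lia|].
      apply (C_eq_by_diff_opp _ _ _ H). ring.
    + destruct (Nat.leb_spec (S k) p); [|lia].
      apply (C_eq_by_diff_opp _ _ _ H). ring.
    + destruct (Nat.leb_spec (S k) p); [lia|].
      destruct (Nat.eqb_spec k p); [lia|]. ring.
Qed.

Lemma ps_mul_trunc (p : nat) (u v : ps) (k : nat) : (p <= k)%nat ->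
  ps_mul (ps_trunc p u) v k = sum_n_m (fun l => u l * v (k - l)%nat) 0 p.
Proof.
  intros Hpk. rewrite ps_mul_sum.
  rewrite (sum_n_m_Chasles (G := C_AbelianMonoid) _ 0 p k) by lia.
  rewrite (sum_n_m_ext_loc _ (fun _ => zero) (S p)).
  - rewrite sum_n_m_const_zero, plus_zero_r. apply sum_n_m_ext_loc. intros l Hl.
    unfold ps_trunc. destruct (Nat.leb_spec l p); [easy|lia].
  - intros l Hl. unfold ps_trunc. destruct (Nat.leb_spec l p); [lia|].
    apply Cmult_0_l.
Qed.

(** * Riccati equations for the series of phi, and rho as their logarithm *)

Definition phi_ser (s : sgn) (a b : zseq) (n : Z) : ps :=
  fun k => phi s a b (Z.of_nat k + pm1 s) n.

Definition rho_ser (s : sgn) (a b : zseq) (n : Z) : ps := fun k => rho s a b k n.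

Lemma phi_ser_0 (s : sgn) (a b : zseq) (n : Z) : phi_ser s a b n O = 1.
Proof. now destruct s. Qed.

Lemma phi_ser_plus_1 (a b : zseq) (n : Z) : phi_ser Plus a b n 1%nat = b (n + 1)%Z.
Proof. reflexivity. Qed.

Lemma phi_ser_plus_SS (a b : zseq) (n : Z) (k : nat) :
  phi_ser Plus a b n (S (S k))
  = b (n + 1)%Z * phi_ser Plus a b n (S k)
    + a (n + 1)%Z * a (n + 1)%Z
      * ps_mul (phi_ser Plus a b n) (phi_ser Plus a b (n + 1)%Z) k.
Proof.
  unfold phi_ser at 1. simpl pm1. rewrite phi_plus_rec by lia.
  rewrite ps_mul_sum. unfold Sp, phi_ser; simpl pm1.
  f_equal; [do 2 f_equal; lia|]. f_equal.
  replace (S (S k) - 1)%nat with (S k) by lia. rewrite <- sum_n_m_S.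
  apply sum_n_m_ext_loc. intros l Hl. rewrite Cmult_comm. f_equal; f_equal; lia.
Qed.

Lemma phi_ser_minus_1 (a b : zseq) (n : Z) : phi_ser Minus a b n 1%nat = - b n.
Proof. reflexivity. Qed.

Lemma phi_ser_minus_2 (a b : zseq) (n : Z) :
  phi_ser Minus a b n 2%nat = - (a (n - 1)%Z * a (n - 1)%Z).
Proof. reflexivity. Qed.

(** The sum in the recursion runs over indices from 0 on and so leaves out the leading coefficient
    with index -1; hence a product of tails. *)
Lemma phi_ser_minus_SSS (a b : zseq) (n : Z) (k : nat) :
  phi_ser Minus a b n (S (S (S k)))
  = - b n * phi_ser Minus a b (n - 1)%Z (S (S k))
    - ps_mul (fun i => phi_ser Minus a b n (S i))
        (fun i => phi_ser Minus a b (n - 1)%Z (S i)) (S k).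
Proof.
  unfold phi_ser at 1. simpl pm1.
  replace (Z.of_nat (S (S (S k))) + -1)%Z with (Z.of_nat (S k) + 1)%Z by lia.
  rewrite phi_minus_rec by lia.
  rewrite ps_mul_comm_coef, ps_mul_sum. unfold Sm, phi_ser; simpl pm1.
  apply (f_equal2 Cminus); [do 2 f_equal; lia|].
  apply sum_n_m_ext_loc. intros l Hl. rewrite Cmult_comm. f_equal; f_equal; lia.
Qed.

(** With phi = w a X and z = 1/w this is the Riccati equation a^+ phi^+ + a/phi = z - b^+,
    multiplied by w X. *)
Lemma phi_ser_plus_riccati (a b : zseq) (n : Z) :
  let X := phi_ser Plus a b in
  (X n = ps_one + ps_w * (ps_mono 0 (b (n + 1)%Z) * X n)
         + ps_w * (ps_w * (ps_mono 0 (a (n + 1)%Z * a (n + 1)%Z) * (X n * X (n + 1)%Z))))%ps.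
Proof.
  intros X. apply functional_extensionality. intros k.
  unfold ps_add. rewrite !ps_mul_mono. destruct k as [|[|k]].
  - unfold X, ps_mono. rewrite phi_ser_0. simpl. ring.
  - simpl. unfold X, ps_mono. rewrite phi_ser_plus_1, phi_ser_0. simpl. ring.
  - simpl. unfold X. rewrite phi_ser_plus_SS, !Nat.sub_0_r.
    change (ps_one (S (S k))) with (RtoC 0). ring.
Qed.

(** With phi = Y/(a w) this is the same equation at n, a phi + a^-/phi^- = z - b, multiplied by w
    Y^-. *)
Lemma phi_ser_minus_riccati (a b : zseq) (n : Z) :
  let Y := phi_ser Minus a b in
  (Y n * Y (n - 1)%Z + (ps_w * ps_mono 0 (b n) - ps_one) * Y (n - 1)%Z
   + ps_w * (ps_w * ps_mono 0 (a (n - 1)%Z * a (n - 1)%Z)) = ps_zero)%ps.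
Proof.
  intros Y.
  transitivity (Y n * Y (n - 1)%Z + (ps_w * (ps_mono 0 (b n) * Y (n - 1)%Z) - Y (n - 1)%Z)
   + ps_w * (ps_w * ps_mono 0 (a (n - 1)%Z * a (n - 1)%Z)))%ps; [ring|].
  apply functional_extensionality. intros k.
  unfold ps_add, ps_opp. rewrite !ps_mul_mono. destruct k as [|[|[|k]]].
  - simpl. unfold Y. rewrite !phi_ser_0. ring.
  - simpl. unfold Y. rewrite !phi_ser_minus_1, !phi_ser_0. ring.
  - simpl. unfold Y, ps_mono. rewrite !phi_ser_minus_2, !phi_ser_minus_1, !phi_ser_0.
    simpl. ring.
  (* Peeling off the first and the last term of the product leaves the product of tails in
     [phi_ser_minus_SSS]. The first term cancels the summand -Y(n-1), the last one is the
     coefficient being defined. *)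
  - rewrite ps_mul_S_r. change (ps_mul (Y n) ?v (S (S k)))
      with (Y n O * v (S (S k)) + ps_mul (fun i => Y n (S i)) v (S k)).
    cbv beta. unfold Y. rewrite (phi_ser_minus_SSS a b n), !phi_ser_0.
    replace (S (S (S k)) - 1)%nat with (S (S k)) by lia. rewrite !Nat.sub_0_r.
    change (S (S (S k)) <? 1)%nat with false. change (S (S k) <? 1)%nat with false.
    change (S (S k) <? 0)%nat with false. cbv iota.
    change (ps_mono 0 ?x (S (S k) - 1)%nat) with (RtoC 0). ring.
Qed.

Lemma rho_ser_0 (s : sgn) (a b : zseq) (n : Z) : rho_ser s a b n O = 0.
Proof. reflexivity. Qed.

Lemma rho_ser_S (s : sgn) (a b : zseq) (n : Z) (j : nat) :
  rho_ser s a b n (S j)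
  = phi_ser s a b n (S j)
    - sum_n_m (fun l => RtoC (INR l / INR (S j)) * phi_ser s a b n (S j - l)%nat
                        * rho_ser s a b n l) 1 j.
Proof.
  destruct j as [|j].
  - rewrite sum_n_m_zero by lia.
    change (phi_ser s a b n 1%nat = phi_ser s a b n 1%nat - 0). ring.
  - unfold rho_ser at 1. rewrite rho_rec by lia.
    replace (S (S j) - 1)%nat with (S j) by lia.
    unfold phi_ser at 1. apply (f_equal (Cminus _)).
    apply sum_n_m_ext_loc. intros l Hl. unfold phi_ser. do 3 f_equal. lia.
Qed.

(** The coefficient of w^j says j X_j = sum of l rho_l X_(j-l) over l from 1 to j, which is j times
    the recursion defining rho. *)
Lemma phi_ser_log (s : sgn) (a b : zseq) (n : Z) :
  ps_theta (phi_ser s a b n) = (phi_ser s a b n * ps_theta (rho_ser s a b n))%ps.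
Proof.
  apply functional_extensionality. intros [|j].
  - unfold ps_theta. simpl. ring.
  - rewrite ps_mul_comm_coef, ps_mul_sum, sum_Sn_m by lia.
    rewrite (sum_n_Sm _ 1) by lia. rewrite Nat.sub_diag, phi_ser_0.
    unfold ps_theta. rewrite (rho_ser_S s a b n j).
    assert (HS : RtoC (INR (S j)) <> 0).
    { intros E. apply RtoC_inj in E. now apply not_0_INR in E. }
    set (S1 := sum_n_m (fun l => RtoC (INR l / INR (S j)) * _ * _) 1 j).
    replace (sum_n_m _ 1 j) with (INR (S j) * S1).
    + unfold plus; simpl AbelianMonoid.plus. change (INR 0) with 0%R.
      change (RtoC (INR (S j)) * phi_ser s a b n (S j)
        = 0 * rho_ser s a b n 0 * phi_ser s a b n (S j - 0)%nat
          + (INR (S j) * S1 + INR (S j) * (phi_ser s a b n (S j) - S1) * 1)). ring.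
    + unfold S1. rewrite <- (sum_n_m_mult_l (K := C_Ring)).
      apply sum_n_m_ext_loc. intros l Hl.
      change (RtoC (INR (S j)) * (RtoC (INR l / INR (S j)) * phi_ser s a b n (S j - l)%nat
                          * rho_ser s a b n l)
        = INR l * rho_ser s a b n l * phi_ser s a b n (S j - l)%nat).
      rewrite RtoC_div by now apply not_0_INR. field. exact HS.
Qed.

(** * Polynomial identities behind the flow *)

Lemma ps_eq_by_diff (e x y : ps) : e = ps_zero -> (x - y)%ps = e -> x = y.
Proof. intros He H. transitivity (x - y + y)%ps; [ring|]. rewrite H, He. ring. Qed.

(** Shows that X (S^+ - I) V satisfies the linearized Riccati equation in the solved form of
    [plus_flow_step]. The letters 0, 1, 2 stand for the sites n, n+1, n+2, A for a^2, P for 2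
    f_(p+1) w^(p+1), and beta for w^(p+1) b_t at n+1. *)
Lemma plus_flow_identity
  (w two b1 b2 A0 A1 A2 X0 X1 X2 F0 F1 F2 G0 G1 G2 P1 P2 beta : ps) :
  (X0 = ps_one + w * (b1 * X0) + w * (w * (A1 * (X0 * X1))))%ps ->
  (X1 = ps_one + w * (b2 * X1) + w * (w * (A2 * (X1 * X2))))%ps ->
  (P1 = two - two * F1 - w * (G1 + G0) + w * (two * (b1 * F1)))%ps ->
  (P2 = two - two * F2 - w * (G2 + G1) + w * (two * (b2 * F2)))%ps ->
  (beta = G1 - G0 - w * (b1 * (G1 - G0)) + w * (two * (A1 * F2 - A0 * F0)))%ps ->
  let V0 := (two * (A0 * (w * (w * (F0 * X0)))) + w * G0)%ps in
  let V1 := (two * (A1 * (w * (w * (F1 * X1)))) + w * G1)%ps in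
  let V2 := (two * (A2 * (w * (w * (F2 * X2)))) + w * G2)%ps in
  (X0 * (V1 - V0)
   = X0 * (X0 * (w * beta + w * (w * (A1 * (P2 - P1) * X1))))
     + w * (w * (A1 * (X0 * X0))) * (X1 * (V2 - V1)))%ps.
Proof.
  intros H1 H2 R1 R2 Rb V0 V1 V2.
  set (h1 := (X0 - (ps_one + w * (b1 * X0) + w * (w * (A1 * (X0 * X1)))))%ps).
  set (h2 := (X1 - (ps_one + w * (b2 * X1) + w * (w * (A2 * (X1 * X2)))))%ps).
  (* Once P1, P2 and beta are eliminated by the truncated recursions, the difference of the two
     sides is this explicit combination of the residuals of the two Riccati equations. *)
  apply (ps_eq_by_diff (X0 * X0 * w * w * A1 * two * F2 * h2
           - (X0 * (V1 - V0) + X0 * X0 * two * w * w * A0 * F0) * h1)%ps).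
  - replace h1 with ps_zero; [replace h2 with ps_zero|]; [ring| |].
    + unfold h2. rewrite <- H2. ring.
    + unfold h1. rewrite <- H1. ring.
  - unfold h1, h2, V0, V1, V2. rewrite R1, R2, Rb. ring.
Qed.

(** The counterpart for the minus sign: Y (S^+ - I) V satisfies the linearized Riccati equation
    itself. The letters m, 0, 1 stand for the sites n-1, n, n+1, and beta belongs to n. *)
Lemma minus_flow_identity
  (w two b0 b1 Am A0 Ym Y0 Y1 Fm F0 F1 Gm G0 G1 Pm P0 P1 beta : ps) :
  (Y0 * Ym + (w * b0 - ps_one) * Ym + w * (w * Am) = ps_zero)%ps ->
  (Y1 * Y0 + (w * b1 - ps_one) * Y0 + w * (w * A0) = ps_zero)%ps ->
  (P0 = two - two * F0 - w * (G0 + Gm) + w * (two * (b0 * F0)))%ps ->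
  (P1 = two - two * F1 - w * (G1 + G0) + w * (two * (b1 * F1)))%ps ->
  (beta = G0 - Gm - w * (b0 * (G0 - Gm)) + w * (two * (A0 * F1 - Am * Fm)))%ps ->
  let Vm := (two * (Fm * Ym) + w * Gm + Pm)%ps in
  let V0 := (two * (F0 * Y0) + w * G0 + P0)%ps in
  let V1 := (two * (F1 * Y1) + w * G1 + P1)%ps in
  (Ym * (Y0 * (V1 - V0)) + (Y0 + w * b0 - ps_one) * (Ym * (V0 - Vm))
   + w * (beta * Ym) + w * (w * (Am * (P0 - Pm))) = ps_zero)%ps.
Proof.
  intros H0 H1 R0 R1 Rb Vm V0 V1.
  transitivity (two * F1 * Ym * (Y1 * Y0 + (w * b1 - ps_one) * Y0 + w * (w * A0))
    + (P0 - Pm - two * (Fm * Ym))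
      * (Y0 * Ym + (w * b0 - ps_one) * Ym + w * (w * Am)))%ps.
  - unfold V0, V1, Vm. rewrite R0, R1, Rb. ring.
  - rewrite H0, H1. ring.
Qed.

(** * Differentiability in time of phi and rho *)

Lemma ex_deriv_ext (f g : R -> C) (t : R) :
  (forall s, f s = g s) -> ex_deriv f t -> ex_deriv g t.
Proof. intros E [l H]. exists l. exact (is_deriv_ext _ _ _ _ E H). Qed.

Lemma ex_deriv_ps_mul (u v : R -> ps) (t : R) (k : nat) :
  (forall i, (i <= k)%nat -> ex_deriv (fun s => u s i) t) ->
  (forall i, (i <= k)%nat -> ex_deriv (fun s => v s i) t) ->
  ex_deriv (fun s => ps_mul (u s) (v s) k) t.
Proof.
  intros Hu Hv. eapply ex_deriv_ext; [intros s; symmetry; apply ps_mul_sum|].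
  apply (ex_deriv_sum (fun i s => u s i * v s (k - i)%nat)). intros i Hi.
  apply ex_deriv_mult; [apply Hu|apply Hv]; lia.
Qed.

(** Each coefficient is a polynomial in finitely many shifts of a and b. The existence of the
    derivative has to be known before the Riccati equation can be differentiated. *)
Lemma ex_deriv_phi_ser (s : sgn) (a b : Z -> R -> C) (t : R) :
  (forall n, ex_deriv (a n) t) -> (forall n, ex_deriv (b n) t) ->
  forall k n, ex_deriv (fun r => phi_ser s (at_time a r) (at_time b r) n k) t.
Proof.
  intros Ha Hb k. induction k as [k IH] using lt_wf_ind. intros n.
  destruct k as [|k].
  { eapply ex_deriv_ext; [intros r; symmetry; apply phi_ser_0|apply ex_deriv_const]. }
  destruct s, k as [|k].
  - apply Hb.
  - eapply ex_deriv_ext; [intros r; symmetry; apply phi_ser_plus_SS|].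
    apply ex_deriv_plus; apply ex_deriv_mult.
    + apply Hb.
    + apply IH. lia.
    + apply ex_deriv_mult; apply Ha.
    + apply ex_deriv_ps_mul; intros i Hi; apply IH; lia.
  - apply ex_deriv_opp, Hb.
  - destruct k as [|k].
    + apply ex_deriv_opp, ex_deriv_mult; apply Ha.
    + eapply ex_deriv_ext; [intros r; symmetry; apply phi_ser_minus_SSS|].
      apply ex_deriv_plus; [|apply ex_deriv_opp].
      * apply ex_deriv_mult; [apply ex_deriv_opp, Hb|apply IH; lia].
      * apply (ex_deriv_ps_mul
                 (fun r i => phi_ser Minus (at_time a r) (at_time b r) n (S i))
                 (fun r i => phi_ser Minus (at_time a r) (at_time b r) (n - 1)%Z (S i)));
          intros i Hi; apply IH; lia.
Qed.

Lemma ex_deriv_rho_ser (s : sgn) (a b : Z -> R -> C) (t : R) :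
  (forall n, ex_deriv (a n) t) -> (forall n, ex_deriv (b n) t) ->
  forall k n, ex_deriv (fun r => rho_ser s (at_time a r) (at_time b r) n k) t.
Proof.
  intros Ha Hb k. induction k as [k IH] using lt_wf_ind. intros n.
  destruct k as [|k].
  { eapply ex_deriv_ext; [intros r; symmetry; apply rho_ser_0|apply ex_deriv_const]. }
  eapply ex_deriv_ext; [intros r; symmetry; apply rho_ser_S|].
  apply ex_deriv_plus; [|apply ex_deriv_opp]; [now apply ex_deriv_phi_ser|].
  apply (ex_deriv_sum (fun l r => RtoC (INR l / INR (S k))
           * phi_ser s (at_time a r) (at_time b r) n (S k - l)%nat
           * rho_ser s (at_time a r) (at_time b r) n l)).
  intros l Hl. apply ex_deriv_mult; [apply ex_deriv_mult|].
  - apply ex_deriv_const.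
  - now apply ex_deriv_phi_ser.
  - apply IH. lia.
Qed.

(** An explicit derivative through the total function [Derive], so that a whole family indexed by
    the sites can be formed without choice. *)
Definition ps_Derive (u : R -> ps) (t : R) : ps :=
  fun k => (Derive (fun s => Re (u s k)) t, Derive (fun s => Im (u s k)) t).

Lemma ps_Derive_correct (u : R -> ps) (t : R) :
  (forall k, ex_deriv (fun s => u s k) t) -> ps_deriv u t (ps_Derive u t).
Proof.
  intros H k. destruct (H k) as [l Hl]. refine (eq_rect _ (is_deriv _ t) Hl _ _).
  apply is_deriv_components in Hl as [H1 H2].
  apply is_derive_unique in H1, H2. unfold ps_Derive. destruct l; simpl in *. congruence.
Qed.

(** * The potential V and the Toda flow at a fixed time *)

(** Zero curvature gives w^(p+1) (ln phi)_t = (S^+ - I)(2 a w F phi + w G + f_(p+1) w^(p+1)). Since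
    (ln a)_t = (S^+ - I) f_(p+1), passing from phi to X divides by a and removes the last term for
    the plus sign, but multiplies by a and doubles it for the minus sign. *)
Definition flow_potential (s : sgn) (p : nat) (c : nat -> C) (a b : zseq) (n : Z) : ps :=
  let F := ps_trunc p (f_ser c a b n) in
  let G := ps_trunc p (g_ser c a b n) in
  match s with
  | Plus => (ps_two * (ps_mono 0 (a n * a n) * (ps_w * (ps_w * (F * phi_ser Plus a b n))))
             + ps_w * G)%ps
  | Minus => (ps_two * (F * phi_ser Minus a b n) + ps_w * G
              + ps_mono (S p) (2 * fT c a b (S p) n))%ps
  end.

(** In degree p + 1 + j with j >= 1 neither w G nor the monomial of degree p + 1 contributes. The
    convolution of F with X remains, and its index p + 1 + j - l, lowered by 2 through w^2 for the
    plus sign, becomes p + j - l after the shift in [phi_ser]. *)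
Lemma current_flow_potential (s : sgn) (p : nat) (c : nat -> C) (a b : zseq) (n : Z)
  (j : nat) : (1 <= j)%nat ->
  current s c a b p j n = - flow_potential s p c a b n (S p + j)%nat.
Proof.
  intros Hj. unfold flow_potential, current.
  destruct s; unfold ps_add; rewrite ?ps_mul_mono.
  - destruct (Nat.ltb_spec (S p + j) 0); [lia|].
    destruct (Nat.ltb_spec (S p + j) 1); [lia|].
    destruct (Nat.ltb_spec (S p + j - 0 - 0) 1); [lia|].
    destruct (Nat.ltb_spec (S p + j - 0 - 0 - 1) 1); [lia|].
    destruct (Nat.ltb_spec (S p + j - 0) 0); [lia|].
    rewrite ps_mul_trunc by lia.
    unfold ps_trunc. destruct (Nat.leb_spec (S p + j - 1) p); [lia|].
    rewrite (sum_n_m_ext_loc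
      (fun l => f_ser c a b n l * phi_ser Plus a b n (S p + j - 0 - 0 - 1 - 1 - l)%nat)
      (fun l => fT c a b l n * phi Plus a b (Z.of_nat p + Z.of_nat j - Z.of_nat l) n)); [ring|].
    intros l Hl. unfold phi_ser, f_ser; simpl pm1. do 2 f_equal. lia.
  - destruct (Nat.ltb_spec (S p + j) 0); [lia|].
    destruct (Nat.ltb_spec (S p + j) 1); [lia|].
    rewrite ps_mul_trunc by lia.
    unfold ps_trunc. destruct (Nat.leb_spec (S p + j - 1) p); [lia|].
    unfold ps_mono. destruct (Nat.eqb_spec (S p + j) (S p)); [lia|].
    rewrite (sum_n_m_ext_loc (fun l => f_ser c a b n l * phi_ser Minus a b n (S p + j - 0 - l)%nat)
      (fun l => fT c a b l n * phi Minus a b (Z.of_nat p + Z.of_nat j - Z.of_nat l) n)); [ring|].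
    intros l Hl. unfold phi_ser, f_ser; simpl pm1. do 2 f_equal. lia.
Qed.

Definition toda_flow (p : nat) (c : nat -> C) (a b : Z -> R -> C) (t : R) : Prop :=
  let f := fT c (at_time a t) (at_time b t) (S p) in
  let g := gT c (at_time a t) (at_time b t) (S p) in
  forall n, is_deriv (a n) t (a n t * (f (n + 1)%Z - f n))
            /\ is_deriv (b n) t (- (g n - g (n - 1)%Z)).

Lemma ps_mul_mono_mono (m : nat) (x y : C) :
  (ps_mono m x * ps_mono 0 y)%ps = ps_mono m (x * y).
Proof.
  apply functional_extensionality. intros k. rewrite ps_mul_mono. unfold ps_mono.
  destruct (Nat.ltb_spec k m), (Nat.eqb_spec k m), (Nat.eqb_spec (k - m) 0);
    try lia; ring.
Qed.

Lemma ps_mono_sub (m : nat) (x y : C) :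
  ps_mono m (x - y) = (ps_mono m x - ps_mono m y)%ps.
Proof.
  apply functional_extensionality. intros k. unfold ps_mono, ps_add, ps_opp.
  destruct (k =? m)%nat; ring.
Qed.

(** The Riccati equations contain a only through a^2, whose derivative is 2 a^2 (f_(p+1)^+ -
    f_(p+1)). *)
Lemma toda_flow_square (p : nat) (c : nat -> C) (a b : Z -> R -> C) (t : R) (n : Z) :
  toda_flow p c a b t ->
  let P m := ps_mono (S p) (2 * fT c (at_time a t) (at_time b t) (S p) m) in
  exists dA, is_deriv (fun r => a n r * a n r) t dA /\
    (ps_mono (S p) 1 * ps_mono 0 dA
     = ps_mono 0 (a n t * a n t) * (P (n + 1)%Z - P n))%ps.
Proof.
  intros Ht P. destruct (Ht n) as [Ha _].
  eexists. split; [exact (is_deriv_mult _ _ _ _ _ Ha Ha)|].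
  unfold P. rewrite <- ps_mono_sub.
  transitivity (ps_mono (S p) (2 * fT c (at_time a t) (at_time b t) (S p) (n + 1)%Z
        - 2 * fT c (at_time a t) (at_time b t) (S p) n) * ps_mono 0 (a n t * a n t))%ps;
    [|ring].
  rewrite !ps_mul_mono_mono. f_equal. ring.
Qed.

(** * The linearized Riccati equations and the evolution of phi *)

Lemma ps_deriv_ext (u v : R -> ps) (t : R) (d : ps) :
  (forall s, u s = v s) -> ps_deriv u t d -> ps_deriv v t d.
Proof. intros E. now rewrite (functional_extensionality u v E). Qed.

Lemma plus_riccati_deriv (B A X X1 : R -> ps) (t : R) (dB dA dX dX1 : ps) :
  (forall s, X s = ps_one + ps_w * (B s * X s) + ps_w * (ps_w * (A s * (X s * X1 s))))%ps ->
  ps_deriv B t dB -> ps_deriv A t dA -> ps_deriv X t dX -> ps_deriv X1 t dX1 ->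
  (dX = ps_w * (dB * X t + B t * dX)
        + ps_w * (ps_w * (dA * (X t * X1 t) + A t * (dX * X1 t + X t * dX1))))%ps.
Proof.
  intros H HB HA HX HX1. apply (ps_deriv_unique X t); [exact HX|].
  pose proof (ps_deriv_const ps_w t) as Hw.
  pose proof (ps_deriv_add _ _ _ _ _
    (ps_deriv_add _ _ _ _ _ (ps_deriv_const ps_one t)
       (ps_deriv_mul _ _ _ _ _ Hw (ps_deriv_mul _ _ _ _ _ HB HX)))
    (ps_deriv_mul _ _ _ _ _ Hw (ps_deriv_mul _ _ _ _ _ Hw
       (ps_deriv_mul _ _ _ _ _ HA (ps_deriv_mul _ _ _ _ _ HX HX1))))) as HR.
  apply (ps_deriv_ext _ _ _ _ (fun s => eq_sym (H s))).
  refine (eq_rect _ (ps_deriv _ t) HR _ _). ring.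
Qed.

Lemma minus_riccati_deriv (B A Y Ym : R -> ps) (t : R) (dB dA dY dYm : ps) :
  (forall s, Y s * Ym s + (ps_w * B s - ps_one) * Ym s + ps_w * (ps_w * A s)
             = ps_zero)%ps ->
  ps_deriv B t dB -> ps_deriv A t dA -> ps_deriv Y t dY -> ps_deriv Ym t dYm ->
  (dY * Ym t + (Y t + ps_w * B t - ps_one) * dYm + ps_w * (dB * Ym t)
   + ps_w * (ps_w * dA) = ps_zero)%ps.
Proof.
  intros H HB HA HY HYm. apply (ps_deriv_unique (fun _ => ps_zero) t);
    [|apply ps_deriv_const].
  pose proof (ps_deriv_const ps_w t) as Hw.
  pose proof (ps_deriv_add _ _ _ _ _
    (ps_deriv_add _ _ _ _ _ (ps_deriv_mul _ _ _ _ _ HY HYm)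
       (ps_deriv_mul _ _ _ _ _ (ps_deriv_add _ _ _ _ _
          (ps_deriv_mul _ _ _ _ _ Hw HB)
          (ps_deriv_opp _ _ _ (ps_deriv_const ps_one t))) HYm))
    (ps_deriv_mul _ _ _ _ _ Hw (ps_deriv_mul _ _ _ _ _ Hw HA))) as HR.
  apply (ps_deriv_ext _ _ _ _ H).
  refine (eq_rect _ (ps_deriv _ t) HR _ _). ring.
Qed.

(** Multiplying the linearized equation by X and using X (1 - w b - w^2 A X1) = 1 solves it for E.
    Then E1 carries the factor w^2, as the uniqueness principle requires. *)
Lemma plus_flow_step (w b A al be X X1 E E1 Q1 : ps) :
  (X = ps_one + w * (b * X) + w * (w * (A * (X * X1))))%ps ->
  (E = w * (be * X + b * E) + w * (w * (al * (X * X1) + A * (E * X1 + X * E1))))%ps ->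
  (E - (X * (X * (w * be + w * (w * (al * X1)))) + w * (w * (A * (X * X))) * Q1)
   = w * (w * (A * (X * X))) * (E1 - Q1))%ps.
Proof.
  intros HX HE.
  set (h := (X - (ps_one + w * (b * X) + w * (w * (A * (X * X1)))))%ps).
  set (r := (E - (w * (be * X + b * E)
                  + w * (w * (al * (X * X1) + A * (E * X1 + X * E1)))))%ps).
  apply (ps_eq_by_diff (X * r - h * E)%ps).
  - replace h with ps_zero; [replace r with ps_zero|]; [ring| |].
    + unfold r. rewrite <- HE. ring.
    + unfold h. rewrite <- HX. ring.
  - unfold h, r. ring.
Qed.

Lemma minus_flow_step (w b al be Y Ym E Em Q Qm : ps) :
  (E * Ym + (Y + w * b - ps_one) * Em + w * (be * Ym) + w * (w * al) = ps_zero)%ps ->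
  (Ym * Q + (Y + w * b - ps_one) * Qm + w * (be * Ym) + w * (w * al) = ps_zero)%ps ->
  (Ym * (E - Q) = - (Y + w * b - ps_one) * (Em - Qm))%ps.
Proof.
  intros HE HQ.
  apply (ps_eq_by_diff
    ((E * Ym + (Y + w * b - ps_one) * Em + w * (be * Ym) + w * (w * al))
     - (Ym * Q + (Y + w * b - ps_one) * Qm + w * (be * Ym) + w * (w * al)))%ps); [|ring].
  rewrite HE, HQ. ring.
Qed.

(* Both sides solve the linearized Riccati equation, whose solution is unique in
   formal power series. *)
Lemma phi_ser_flow (s : sgn) (p : nat) (c : nat -> C) (hc0 : c O = 1)
  (a b : Z -> R -> C) (t : R) (dX : Z -> ps) :
  toda_flow p c a b t ->
  (forall n, ps_deriv (fun r => phi_ser s (at_time a r) (at_time b r) n) t (dX n)) ->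
  forall n,
  let V := flow_potential s p c (at_time a t) (at_time b t) in
  (ps_mono (S p) 1 * dX n
   = phi_ser s (at_time a t) (at_time b t) n * (V (n + 1)%Z - V n))%ps.
Proof.
  intros Ht HdX n V.
  set (X := phi_ser s (at_time a t) (at_time b t)).
  set (W := ps_mono (S p) 1).
  set (A := fun m => ps_mono 0 (a m t * a m t)).
  set (B := fun m => ps_mono 0 (b m t)).
  set (P := fun m => ps_mono (S p) (2 * fT c (at_time a t) (at_time b t) (S p) m)).
  set (db := fun m => - (gT c (at_time a t) (at_time b t) (S p) m
                         - gT c (at_time a t) (at_time b t) (S p) (m - 1)%Z)).
  (* Everything is scaled by w^(p+1), because the Toda equation enters as the defect in degree p + 1
     of the truncated recursions. *)
  set (D := fun m => (W * dX m - X m * (V (m + 1)%Z - V m))%ps).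
  enough (Z : D n = ps_zero).
  { transitivity (D n + X n * (V (n + 1)%Z - V n))%ps; [unfold D; ring|].
    rewrite Z. ring. }
  assert (HB : forall m, ps_deriv (fun r => ps_mono 0 (b m r)) t (ps_mono 0 (db m))).
  { intros m. apply (ps_deriv_mono 0), Ht. }
  assert (EB : forall m, (W * ps_mono 0 (db m))%ps = ps_mono (S p) (db m)).
  { intros m. unfold W. now rewrite ps_mul_mono_mono, Cmult_1_l. }
  assert (HA : forall m, exists dA, ps_deriv (fun r => ps_mono 0 (a m r * a m r)) t dA
                 /\ (W * dA = A m * (P (m + 1)%Z - P m))%ps).
  { intros m. destruct (toda_flow_square p c a b t m Ht) as [dA [H1 H2]].
    exists (ps_mono 0 dA). split; [now apply (ps_deriv_mono 0)|exact H2]. }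
  assert (Rf := f_trunc_rec p c hc0 (at_time a t) (at_time b t)).
  assert (Rg := g_trunc_rec p c (at_time a t) (at_time b t)).
  cbv zeta in Rf, Rg. revert n. destruct s.
  (* For the plus sign uniqueness propagates from n + 1 to n: D(n) is w^2 a^2 X^2 D(n+1), with a
     taken at n + 1. *)
  - apply (ps_shift_eq_zero (fun m => (m + 1)%Z) (fun _ => ps_one)
             (fun m => ps_w * (ps_w * (A (m + 1)%Z * (X m * X m))))%ps).
    { reflexivity. }
    { intros m. now rewrite ps_mul_mono. }
    intros m. destruct (HA (m + 1)%Z) as [dA [HdA EA]].
    assert (Ric := phi_ser_plus_riccati (at_time a t) (at_time b t)).
    cbv zeta in Ric. fold X in Ric.
    assert (DR := plus_riccati_deriv _ _ _ _ t _ _ _ _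
                    (fun r => phi_ser_plus_riccati (at_time a r) (at_time b r) m)
                    (HB (m + 1)%Z) HdA (HdX m) (HdX (m + 1)%Z)).
    cbv beta in DR. fold X in DR. fold (A (m + 1)%Z) (B (m + 1)%Z) in DR.
    assert (Rf1 := Rf (m + 1)%Z). assert (Rf2 := Rf (m + 1 + 1)%Z).
    assert (Rg1 := Rg (m + 1)%Z). fold (db (m + 1)%Z) in Rg1.
    replace (m + 1 + 1 - 1)%Z with (m + 1)%Z in * by lia.
    replace (m + 1 - 1)%Z with m in * by lia.
    assert (Id := plus_flow_identity _ _ _ _ _ _ _ _ _ _ _ _ _ _ _ _ _ _ _
                    (Ric m) (Ric (m + 1)%Z) Rf1 Rf2 Rg1).
    cbv zeta in Id.
    (* The local series V0, V1, V2 of the identity are [flow_potential] at m, m + 1, m + 2 by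
       unfolding. *)
    change (X m * (V (m + 1)%Z - V m)
      = X m * (X m * (ps_w * ps_mono (S p) (db (m + 1)%Z)
          + ps_w * (ps_w * (A (m + 1)%Z * (P (m + 1 + 1)%Z - P (m + 1)%Z) * X (m + 1)%Z))))
        + ps_w * (ps_w * (A (m + 1)%Z * (X m * X m)))
          * (X (m + 1)%Z * (V (m + 1 + 1)%Z - V (m + 1)%Z)))%ps in Id.
    unfold D. rewrite Id.
    transitivity (W * dX m
      - (X m * (X m * (ps_w * ps_mono (S p) (db (m + 1)%Z)
          + ps_w * (ps_w * (A (m + 1)%Z * (P (m + 1 + 1)%Z - P (m + 1)%Z) * X (m + 1)%Z))))
        + ps_w * (ps_w * (A (m + 1)%Z * (X m * X m)))
          * (X (m + 1)%Z * (V (m + 1 + 1)%Z - V (m + 1)%Z))))%ps; [ring|].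
    apply (plus_flow_step _ (B (m + 1)%Z) _ _ _ _ _ _ _ _ (Ric m)).
    rewrite <- EB, <- EA. rewrite DR at 1.
    unfold B, A, at_time. ring.
  (* For the minus sign it propagates from n - 1 to n. The factor X(n-1) of D(n) has constant term
     1, and X(n) + w b - 1 has none. *)
  - apply (ps_shift_eq_zero (fun m => (m - 1)%Z) (fun m => X (m - 1)%Z)
             (fun m => - (X m + ps_w * B m - ps_one))%ps).
    { intros m. apply phi_ser_0. }
    { intros m. unfold ps_opp, ps_add. rewrite ps_mul_mono. unfold X.
      rewrite phi_ser_0. unfold ps_mono. simpl. ring. }
    intros m. destruct (HA (m - 1)%Z) as [dA [HdA EA]].
    assert (Ric := phi_ser_minus_riccati (at_time a t) (at_time b t)).
    cbv zeta in Ric. fold X in Ric.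
    assert (DR := minus_riccati_deriv _ _ _ _ t _ _ _ _
                    (fun r => phi_ser_minus_riccati (at_time a r) (at_time b r) m)
                    (HB m) HdA (HdX m) (HdX (m - 1)%Z)).
    cbv beta in DR. fold X in DR.
    assert (Ric0 := Ric m). assert (Ric1 := Ric (m + 1)%Z).
    assert (Rf0 := Rf m). assert (Rf1 := Rf (m + 1)%Z).
    assert (Rg0 := Rg m). fold (db m) in Rg0.
    replace (m - 1 + 1)%Z with m in * by lia.
    replace (m + 1 - 1)%Z with m in * by lia.
    assert (Id := minus_flow_identity _ _ _ _ _ _ _ _ _
                    (ps_trunc p (f_ser c (at_time a t) (at_time b t) (m - 1)%Z))
                    _ _ _ _ _ (P (m - 1)%Z) _ _ _ Ric0 Ric1 Rf0 Rf1 Rg0).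
    cbv zeta in Id.
    unfold D.
    apply (minus_flow_step _ _ (A (m - 1)%Z * (P m - P (m - 1)%Z))%ps
             (ps_mono (S p) (db m))).
    + rewrite <- EB, <- EA.
      transitivity (W * (dX m * X (m - 1)%Z
          + (X m + ps_w * ps_mono 0 (at_time b t m) - ps_one) * dX (m - 1)%Z
          + ps_w * (ps_mono 0 (db m) * X (m - 1)%Z) + ps_w * (ps_w * dA)))%ps.
      * unfold B, at_time. ring.
      * rewrite DR. ring.
    + replace (m - 1 + 1)%Z with m by lia. exact Id.
Qed.

(** * Evolution of rho and the conservation laws *)

(** The logarithmic relation gives X_t = X rho_t; inserting it in the evolution of X and cancelling
    X, whose constant term is 1, leaves a pure difference. *)
Lemma rho_ser_flow (s : sgn) (p : nat) (c : nat -> C) (hc0 : c O = 1)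
  (a b : Z -> R -> C) (t : R) (n : Z) :
  toda_flow p c a b t ->
  exists dr, ps_deriv (fun r => rho_ser s (at_time a r) (at_time b r) n) t dr /\
    let V := flow_potential s p c (at_time a t) (at_time b t) in
    (ps_mono (S p) 1 * dr = V (n + 1)%Z - V n)%ps.
Proof.
  intros Ht.
  assert (Ha : forall m, ex_deriv (a m) t)
    by (intros m; eexists; exact (proj1 (Ht m))).
  assert (Hb : forall m, ex_deriv (b m) t)
    by (intros m; eexists; exact (proj2 (Ht m))).
  set (dX := fun m => ps_Derive (fun r => phi_ser s (at_time a r) (at_time b r) m) t).
  assert (HdX : forall m,
             ps_deriv (fun r => phi_ser s (at_time a r) (at_time b r) m) t (dX m)).
  { intros m. apply ps_Derive_correct. intros k. now apply ex_deriv_phi_ser. }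
  set (dr := ps_Derive (fun r => rho_ser s (at_time a r) (at_time b r) n) t).
  assert (Hdr : ps_deriv (fun r => rho_ser s (at_time a r) (at_time b r) n) t dr).
  { apply ps_Derive_correct. intros k. now apply ex_deriv_rho_ser. }
  exists dr. split; [exact Hdr|]. intros V.
  apply (ps_mul_cancel (phi_ser s (at_time a t) (at_time b t) n)); [apply phi_ser_0|].
  assert (Hflow := phi_ser_flow s p c hc0 a b t dX Ht HdX n).
  cbv zeta in Hflow. fold V in Hflow. rewrite <- Hflow.
  rewrite (ps_log_deriv _ _ t (dX n) dr
             (fun r => phi_ser_0 s (at_time a r) (at_time b r) n)
             (fun r => rho_ser_0 s (at_time a r) (at_time b r) n)
             (fun r => phi_ser_log s (at_time a r) (at_time b r) n) (HdX n) Hdr).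
  ring.
Qed.

Theorem theorem4p6 (p : nat) (c : nat -> C) (hc0 : c 0%nat = 1)
  (a b : Z -> R -> C)
  (hbound : exists M : R, forall (n : Z) (t : R),
      (Cmod (a n t) + Cmod (b n t) <= M)%R)
  (ha1 : forall n : Z, C1_complex (a n)) (hb1 : forall n : Z, C1_complex (b n))
  (ha0 : forall (n : Z) (t : R), a n t <> 0)
  (hTodaA : forall (n : Z) (t : R),
      let f := fT c (at_time a t) (at_time b t) in
      is_deriv (a n) t (a n t * (Sp (f (p + 1)%nat) n - f (p + 1)%nat n)))
  (hTodaB : forall (n : Z) (t : R),
      let g := gT c (at_time a t) (at_time b t) in
      is_deriv (b n) t (- (g (p + 1)%nat n - Sm (g (p + 1)%nat) n))) :
  (forall (n : Z) (t : R),
      let f := fT c (at_time a t) (at_time b t) in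
      exists da : C, is_deriv (a n) t da /\
        da / a n t - (Sp (f (p + 1)%nat) n - f (p + 1)%nat n) = 0)
  /\
  (forall (s : sgn) (j : nat), (1 <= j)%nat -> forall (n : Z) (t : R),
      let J := current s c (at_time a t) (at_time b t) p j in
      exists drho : C,
        is_deriv (fun t' : R => rho s (at_time a t') (at_time b t') j n) t drho /\
        drho + (Sp J n - J n) = 0).
Proof.
  split.
  (* The witness is the right-hand side of the Toda equation; dividing it by a uses that a has no
     zeros. *)
  - intros n t f. eexists. split; [apply hTodaA|]. fold f. field. apply ha0.
  - intros s j Hj n t J.
    assert (Ht : toda_flow p c a b t).
    { rewrite Nat.add_1_r in hTodaA, hTodaB. intros m. split; [apply hTodaA|apply hTodaB]. }
    destruct (rho_ser_flow s p c hc0 a b t n Ht) as [dr [Hdr E]].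
    exists (dr j). split; [exact (Hdr j)|].
    unfold Sp, J. rewrite !current_flow_potential by exact Hj.
    (* The factor w^(p+1) moves the j-th density to degree p + 1 + j, where V is minus the
       current. *)
    assert (Ej := f_equal (fun u => u (S p + j)%nat) E). cbv beta zeta in Ej.
    rewrite ps_mul_mono in Ej. unfold ps_add, ps_opp in Ej.
    destruct (Nat.ltb_spec (S p + j) (S p)); [lia|].
    replace (S p + j - S p)%nat with j in Ej by lia.
    rewrite Cmult_1_l in Ej. rewrite Ej. ring.
Qed.
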